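(* For all $n\ge1$, \[P_{\mathcal{B}_n}(z)=\sum_{w\in BW^B_n}z^{\operatorname{des}(w)},\] where $BW^B_n$ is the set of signed permutations $w\in\mathfrak{B}_n$ such that every right-to-left maximum of $|w|=|w_1||w_2|\cdots|w_n|$ is negative in $w$ (i.e. $w_i<0$ whenever $|w_i|>|w_j|$ for all $j>i$), and $\operatorname{des}(w)=\#\{i\in\{0,\dots,n-1\}:w(i)>w(i+1)\}$ with $w(0):=0$.
   Context: $\mathfrak{B}_n$ is the group of permutations $w$ of $[\pm n]=\{-n,\dots,-1,1,\dots,n\}$ with $w(-i)=-w(i)$, written in window notation $w_1\cdots w_n$, $w_i=w(i)$. $\mathcal{B}_n$ is the arrangement in $\mathbb{R}^n$ of hyperplanes $x_i=\pm x_j$ ($i<j$) and $x_i=0$. $P_{\mathcal{A}}(z)=\sum_{\mathrm{X}}|\mu(\bot,\mathrm{X})|(z-1)^{\operatorname{codim}\mathrm{X}}$, summed over flats (intersections of subsets of hyperplanes), $\mu$ the Möbius function of the lattice of flats under inclusion, $\bot$ its minimum. *)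

(* Defs.v *)
From HB Require Import structures.
From mathcomp Require Import all_boot all_order all_algebra all_fingroup.
Set Implicit Arguments. Unset Strict Implicit. Unset Printing Implicit Defensive.
Import Order.TTheory GRing.Theory Num.Theory.
Local Open Scope ring_scope.

(* mob_rec s le k x y: the usual recursion
     mu(x,x) = 1,  mu(x,y) = - sum_{x <= z < y} mu(x,z) for x < y,  mu(x,y) = 0 otherwise,
   with fuel k (fuel size s is enough: any strict chain in s has < size s steps). *)
Fixpoint mob_rec (T : eqType) (s : seq T) (le : rel T) (k : nat) (x y : T) : int :=
  match k with
  | 0 => (x == y)%:Z
  | k'.+1 =>
      if x == y then 1
      else if le x y then
        - \sum_(z <- s | le x z && le z y && (z != y)) mob_rec s le k' x z
      else 0
  end.

Definition mobius (T : eqType) (s : seq T) (le : rel T) (x y : T) : int :=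
  mob_rec s le (size s) x y.

Section Arr.
Variable R : realFieldType.
Variable n : nat.

Definition evec (i : 'I_n) : 'rV[R]_n := delta_mx 0 i.

Definition Bnormals : seq 'rV[R]_n :=
  [seq evec i - evec j | i : 'I_n <- enum 'I_n, j <- [seq j : 'I_n <- enum 'I_n | (i < j)%N]]
  ++ [seq evec i + evec j | i : 'I_n <- enum 'I_n, j <- [seq j : 'I_n <- enum 'I_n | (i < j)%N]]
  ++ [seq evec i | i : 'I_n <- enum 'I_n].

Definition hyp (a : 'rV[R]_n) : {vspace 'rV[R]_n} := lker (linfun (mulmxr a^T)).

Definition hypi (i : 'I_(size Bnormals)) : {vspace 'rV[R]_n} :=
  hyp (nth 0 Bnormals i).

Definition flat_of (A : {set 'I_(size Bnormals)}) : {vspace 'rV[R]_n} :=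
  (\bigcap_(i in A) hypi i)%VS.

Definition Bflats : seq {vspace 'rV[R]_n} :=
  undup [seq flat_of A | A : {set 'I_(size Bnormals)}].

Definition flat_le : rel {vspace 'rV[R]_n} := fun X Y => (X <= Y)%VS.

Definition flat_bot : {vspace 'rV[R]_n} := flat_of setT.

Definition PB : {poly int} :=
  \sum_(X <- Bflats)
     ((`|mobius Bflats flat_le flat_bot X|%N)%:R * ('X - 1) ^+ (n - \dim X)).
End Arr.

(* w = (sigma, eps) encodes the window w_1 ... w_n with
   w_{k+1} = (-1)^{eps k} (sigma k + 1), k : 'I_n.  This is a bijection with B_n. *)
Definition sperm (n : nat) := ({perm 'I_n} * {ffun 'I_n -> bool})%type.

Definition wval n (w : sperm n) (k : 'I_n) : int :=
  (-1) ^+ (w.2 k) * ((w.1 k).+1)%:Z.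

Definition wpos n (w : sperm n) (i : nat) : int :=
  match i with
  | 0 => 0
  | k.+1 => if (k < n)%N =P true is ReflectT h then wval w (Ordinal h) else 0
  end.

Definition des n (w : sperm n) : nat :=
  count (fun i => wpos w i.+1 < wpos w i) (iota 0 n).

Definition BW n (w : sperm n) : bool :=
  [forall i : 'I_n,
     [forall j : 'I_n, (i < j)%N ==> (`|wval w j| < `|wval w i|)] ==> (wval w i < 0)].

(* Main.v *)
Require Import Defs.
From HB Require Import structures.
From mathcomp Require Import all_boot all_order all_algebra all_fingroup.
From mathcomp Require Import zify ring.
Set Implicit Arguments. Unset Strict Implicit. Unset Printing Implicit Defensive.
Import Order.TTheory GRing.Theory Num.Theory.
Local Open Scope ring_scope.

(** The proof compares both sides with the type-B Stirling numbers
    [S(n+1, k) = S(n, k-1) + (2 k + 1) S(n, k)].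

    Arrangement side.  Each flat [X] is cut out by equations [x_i = s_i x_(c i)] with
    [s_i] in [{-1, 0, 1}], and the coordinates fixed by this retraction are free
    parameters on [X].  Hence [X] has [(2 m + 1)^(dim X)] points with integer
    coordinates in [[-m, m]], and [2^k m (m-1) ... (m-k+1)] of them, [k = dim X], lie
    on no smaller flat.  Sorting the points of [X] by the smallest flat through them
    and comparing for all [m] shows that [X] contains [S(dim X, k)] flats of dimension
    [k].  The recurrence of [S] then gives [mu(0, X) = (-1)^d (2 d - 1)!!] for
    [d = dim X], and [P_(n+1) = z ((2 n + 1) P_n - 2 (z - 1) P_n')].

    Permutation side.  A word of length [n+1] arises from one of length [n] by
    inserting [1] or [-1] after moving all other letters away from [0].  This does not
    affect which of the other letters are right-to-left maxima, and the new letter is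
    one only in last position, where it must be [-1].  Counting the insertions that
    create a descent yields the same recurrence. *)

(** * Descents under insertion of the smallest letter *)

Fixpoint seq_des (a : int) (s : seq int) : nat :=
  if s is b :: s' then ((b < a)%R + seq_des b s')%N else 0%N.

Definition seq_insert (T : Type) (i : nat) (x : T) (s : seq T) : seq T :=
  take i s ++ x :: drop i s.

(** The gap before [b] is split off; both sums leave out the gap after the last letter. *)
Lemma sum_seq_insert_cons (a b : int) (s : seq int) :
  \sum_(i < (size s).+1) \sum_(e : bool)
    ('X : {poly int}) ^+ seq_des a (seq_insert i ((-1) ^+ e) (b :: s)) =
    'X^((-1 < a)%R + (b < -1)%R + seq_des b s)
    + 'X^((1 < a)%R + (b < 1)%R + seq_des b s)
    + 'X^((b < a)%R) * \sum_(i < size s) \sum_(e : bool)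
       'X^(seq_des b (seq_insert i ((-1) ^+ e) s)).
Proof.
rewrite /seq_insert big_ord_recl big_bool /= expr1 expr0 !addnA; congr (_ + _).
rewrite mulr_sumr; apply: eq_bigr => i _; rewrite mulr_sumr; apply: eq_bigr => e _.
by rewrite -exprD.
Qed.

(* Of the gaps of the word, [p] keep the number of descents when [1] or [-1] is
   inserted and [q] raise it by one.  Since the word ends with a negative letter,
   its ascents through [0] and its descents through [0] balance up to the sign
   of [a]. *)
Lemma sum_seq_insert (a : int) (s : seq int) :
    all (fun x => 1 < `|x|) (a :: s) -> last a s < 0 ->
  exists p q, [/\ (p + q)%N = size s, (p + (0%R < a)%R)%N = seq_des a s &
    \sum_(i < size s) \sum_(e : bool) ('X : {poly int}) ^+ seq_des a (seq_insert i ((-1) ^+ e) s)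
    = 'X^(seq_des a s) *+ p.*2 + 'X^((seq_des a s).+1) *+ q.*2].
Proof.
elim: s a => [|b s IH] a /=.
  by move=> _ alt0; exists 0%N, 0%N; rewrite big_ord0 !mulr0n addr0; split=> //; lia.
case/andP=> a1 /andP[b1 s1] slt0.
have [|//|p [q [pq pd sumE]]] := IH b; first by rewrite /= b1.
rewrite sum_seq_insert_cons sumE {sumE IH} mulrDr !mulrnAr -!exprD.
set d := seq_des b s in pd *.
(* Letters of absolute value above 1 compare with 1 and -1 as with 0, so both insertions have the
   same effect in this gap. *)
have -> : ((-1 < a)%R + (b < -1)%R = (0 < a)%R + (b < 0)%R :> nat)%N by lia.
have -> : ((1 < a)%R + (b < 1)%R = (0 < a)%R + (b < 0)%R :> nat)%N by lia.
(* The gap keeps the count at a descent between letters of equal sign or an ascent through 0, and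
   raises it otherwise. *)
have [kept|raised] : ((0 < a)%R + (b < 0)%R = (b < a)%R :> nat)%N \/
  ((0 < a)%R + (b < 0)%R = (b < a)%R.+1 :> nat)%N by lia.
- exists p.+1, q; split; [lia|lia|].
  by rewrite kept doubleS -!mul2n !mulrS addnS !addrA.
- exists p, q.+1; split; [lia|lia|].
  by rewrite raised doubleS !mulrS addnS addSn addrCA [RHS]addrCA -addrA addrCA.
Qed.

Lemma seq_des_insert_last (a : int) s x :
  last a s < x -> seq_des a (seq_insert (size s) x s) = seq_des a s.
Proof.
rewrite /seq_insert take_size drop_size; elim: s a => [|b s IH] a /=; first by lia.
by move/IH->.
Qed.

(** The operator of the common recurrence: both sides of the theorem arise from 1 by applying it
    with parameters 0, 1, ..., n-1 in turn. *)
Definition insertion_op (n : nat) (p : {poly int}) : {poly int} :=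
  'X * (p *+ n.*2.+1 - ('X - 1) * p^`() *+ 2).

(** Read on a word of length [n] with [d] descents: of its 2n+1 admissible insertions, 2d keep the
    number of descents and the others raise it by one. *)
Lemma insertion_opXn n d q : (d + q)%N = n ->
  insertion_op n 'X^d = 'X^d *+ d.*2 + 'X^(d.+1) *+ q.*2.+1.
Proof.
move=> <-; rewrite /insertion_op derivXn; case: d => [|d].
  by rewrite expr0 !mulr0n mulr0 mul0rn add0r subr0 mulrnAr mulr1.
rewrite /= !exprS; set x := 'X; set Y := x ^+ d.
have -> : ((x - 1) * (Y *+ d.+1) *+ 2 = x * Y *+ d.+1.*2 - Y *+ d.+1.*2)%R.
  by rewrite mulrnAr -mulrnA muln2 mulrBl mul1r mulrnBl.
have -> : ((d.+1 + q).*2.+1 = q.*2.+1 + d.+1.*2)%N by lia.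
by rewrite mulrnDr opprB addrACA subrr addr0 mulrDr !mulrnAr addrC.
Qed.

Lemma sum_seq_insert0 (s : seq int) :
    s != [::] -> all (fun x => 1 < `|x|) s -> last 0 s < 0 ->
  \sum_(i < (size s).+1) \sum_(e : bool | (i == size s :> nat) ==> e)
     ('X : {poly int}) ^+ seq_des 0 (seq_insert i ((-1) ^+ e) s)
  = insertion_op (size s) 'X^(seq_des 0 s).
Proof.
case: s => // b s _ s1 slt0.
(* The last letter is at most -2, so -1 put after it makes no descent. *)
have lastlt : last b s < -1.
  case/lastP: s s1 slt0 => [|s x] /=; rewrite ?last_rcons ?all_rcons; lia.
rewrite big_ord_recr /= eqxx [X in _ + X](big_pred1 true) /=; last by case.
rewrite expr1 -/(seq_insert _ _ _) (seq_des_insert_last lastlt).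
rewrite (eq_bigr (fun i : 'I_(size s).+1 => \sum_(e : bool)
    ('X : {poly int}) ^+ seq_des 0 (seq_insert i ((-1) ^+ e) (b :: s)))); last first.
  by move=> i _; apply: eq_bigl => e; rewrite (ltn_eqF (ltn_ord i)).
rewrite sum_seq_insert_cons.
have [p [q [pq pd ->]]] := sum_seq_insert s1 slt0.
rewrite /=; move: s1 => /=; set d := seq_des b s in pd * => s1.
rewrite (@insertion_opXn _ _ q); last by lia.
(* As [b] is nonzero, [pd] shows that the word, read after 0, has p+1 descents. *)
have -> : ((b < 0)%R + d = p.+1)%N by lia.
rewrite mulrDr !mulrnAr -!exprD addnS.
have -> : ((b < 0)%R + d = p.+1)%N by lia.
(* In the gap after the initial 0, the letter -1 adds a descent and 1 adds none. *)
have [-> ->] : ((-1 < 0 :> int)%R + (b < -1)%R + d = p.+2)%N /\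
   ((1 < 0 :> int)%R + (b < 1)%R + d = p.+1)%N by lia.
rewrite doubleS !mulrS.
have AC (Y Z A B : {poly int}) : Z + Y + (A + B) + Y = Y + (Y + A) + (Z + B) by ring.
exact: AC.
Qed.

(** * Signed permutations as words, built by inserting the smallest letter *)

Definition wvals n (w : sperm n) : seq int := [seq wval w k | k <- enum 'I_n].

Lemma size_wvals n (w : sperm n) : size (wvals w) = n.
Proof. by rewrite size_map size_enum_ord. Qed.

Lemma nth_wvals n (w : sperm n) (k : 'I_n) : nth 0 (wvals w) k = wval w k.
Proof. by rewrite (nth_map k) ?nth_ord_enum // size_enum_ord. Qed.

Lemma wposS n (w : sperm n) k : (k < n)%N -> wpos w k.+1 = nth 0 (wvals w) k.
Proof.
move=> kn; rewrite /wpos; case: eqP => // h.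
by rewrite -[k]/(nat_of_ord (Ordinal h)) nth_wvals.
Qed.

Lemma seq_desE (a : int) (s : seq int) :
  seq_des a s = count (fun i => nth 0 (a :: s) i.+1 < nth 0 (a :: s) i) (iota 0 (size s)).
Proof.
elim: s a => //= b s IH a; rewrite IH -[1%N]/(1 + 0)%N iotaDl count_map.
by congr (_ + _)%N; apply: eq_count => i /=.
Qed.

Lemma des_wvals n (w : sperm n) : des w = seq_des 0 (wvals w).
Proof.
rewrite seq_desE size_wvals; apply: eq_in_count => i; rewrite mem_iota add0n => ilt.
by cbv beta; rewrite (wposS w ilt); case: i ilt => [//|i] ilt; rewrite wposS // ltnW.
Qed.

Lemma wval_norm n (w : sperm n) k : `|wval w k| = (w.1 k).+1%:Z.
Proof. by rewrite /wval normrM normrX normrN1 expr1n mul1r. Qed.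

Lemma wval_lt0 n (w : sperm n) k : (wval w k < 0) = w.2 k.
Proof. by rewrite /wval; case: (w.2 k); rewrite ?expr1 ?expr0; lia. Qed.

(* [((i, b), w)] becomes [w] with its letters moved away from [0] and [(-1)^b]
   inserted at position [i]. *)
Definition insert_small n (t : 'I_n.+1 * bool * sperm n) : sperm n.+1 :=
  (lift_perm t.1.1 ord0 t.2.1,
   [ffun k => if unlift t.1.1 k is Some k' then t.2.2 k' else t.1.2]).

(** The position [i] is recovered as the preimage of [ord0]; the other data are then read off at [i]
    and off [i]. *)
Lemma insert_small_inj n : injective (@insert_small n).
Proof.
move=> [[i b] [s e]] [[i' b'] [s' e']] [eqs /ffunP eqe].
have eqi : i = i'.
  apply: (@perm_inj _ (lift_perm i ord0 s)).
  by rewrite {2}eqs !lift_perm_id.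
subst i'; have -> : b = b' by have := eqe i; rewrite !ffunE unlift_none.
have -> : e = e' by apply/ffunP=> k; have := eqe (lift i k); rewrite !ffunE liftK.
suff -> : s = s' by [].
apply/permP=> k; apply: (@lift_inj _ ord0).
by rewrite -(lift_perm_lift i) eqs lift_perm_lift.
Qed.

Lemma insert_small_bij n : bijective (@insert_small n).
Proof.
apply: inj_card_bij; first exact: insert_small_inj.
rewrite !card_prod !card_ord card_bool !card_ffun !card_ord card_bool.
by rewrite !card_Sn factS expnS; lia.
Qed.

(** It fixes 0, in keeping with w(0) = 0, and frees the values 1 and -1 for the new letter. *)
Definition away (x : int) : int := x + sgz x.

Lemma wval_insert_small_new n i b (w : sperm n) :
  wval (insert_small (i, b, w)) i = (-1) ^+ b.
Proof. by rewrite /wval /= ffunE unlift_none lift_perm_id mulr1. Qed.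

Lemma wval_insert_small_lift n i b (w : sperm n) k :
  wval (insert_small (i, b, w)) (lift i k) = away (wval w k).
Proof.
rewrite /wval /away /= ffunE liftK lift_perm_lift /= /bump leq0n add1n.
by case: (w.2 k); rewrite ?expr1 ?expr0; lia.
Qed.

Lemma wvals_insert_small n i b (w : sperm n) :
  wvals (insert_small (i, b, w)) = seq_insert i ((-1) ^+ b) [seq away x | x <- wvals w].
Proof.
have iler : (i <= size [seq away x | x <- wvals w])%N.
  by rewrite size_map size_wvals -ltnS.
have szt := size_takel iler.
apply: (@eq_from_nth _ 0).
  by rewrite size_wvals size_cat /= szt size_drop size_map size_wvals addnS subnKC // -ltnS.
rewrite size_wvals => k klt; rewrite -[k]/(nat_of_ord (Ordinal klt)) nth_wvals.
move: (Ordinal klt) => {klt} {}k.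
rewrite nth_cat szt.
case: (unliftP i k) => [j ->|->]; last first.
  by rewrite ltnn subnn wval_insert_small_new.
rewrite wval_insert_small_lift /= /bump.
have [ij|ji] := leqP i j.
  rewrite add1n ltnNge leqW //= subSn //= nth_drop subnKC //.
  by rewrite (nth_map 0) ?nth_wvals ?size_wvals.
by rewrite add0n ji nth_take // (nth_map 0) ?nth_wvals ?size_wvals.
Qed.

Lemma BW_insert_small n i b (w : sperm n) :
  BW (insert_small (i, b, w)) = ((i == n :> nat) ==> b) && BW w.
Proof.
apply/forallP/andP=> [BWw|[bi /forallP BWw] k].
- split.
    apply/implyP=> /eqP i_n; move: (BWw i); rewrite wval_lt0 /= ffunE unlift_none => /implyP; apply.
    by apply/forallP=> j; apply/implyP; rewrite i_n; have := ltn_ord j; lia.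
  apply/forallP=> k; apply/implyP=> /forallP kmax.
  move: (BWw (lift i k)); rewrite !wval_lt0 /= ffunE liftK => /implyP; apply.
  apply/forallP=> j; apply/implyP=> kj; rewrite !wval_norm /= lift_perm_lift.
  case: (unliftP i j) kj => [j' ->|-> _]; last by rewrite lift_perm_id.
  move=> kj; rewrite lift_perm_lift /=; move: (kmax j').
  rewrite !wval_norm /bump; move: kj; rewrite /= /bump; lia.
apply/implyP=> /forallP kmax; rewrite wval_lt0 /= ffunE.
case: (unliftP i k) kmax => [k' ->|->] kmax.
  move: (BWw k'); rewrite wval_lt0 => /implyP; apply.
  apply/forallP=> j; apply/implyP=> kj; move: (kmax (lift i j)).
  rewrite !wval_norm /= !lift_perm_lift /= /bump; lia.
(* Unless it stands last, the new letter is followed by one of larger absolute value and is no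
   right-to-left maximum. *)
apply: (implyP bi); rewrite eqn_leq -ltnS ltn_ord /= leqNgt; apply/negP=> i_n.
by move: (kmax ord_max); rewrite i_n !wval_norm /= lift_perm_id.
Qed.

Lemma away_lt x y : (away x < away y) = (x < y).
Proof. rewrite /away; lia. Qed.

Lemma seq_des_away a s : seq_des (away a) [seq away x | x <- s] = seq_des a s.
Proof. by elim: s a => //= b s IH a; rewrite IH away_lt. Qed.

Lemma insertion_op_sum n (I : finType) (P : pred I) (F : I -> {poly int}) :
  insertion_op n (\sum_(i | P i) F i) = \sum_(i | P i) insertion_op n (F i).
Proof.
by rewrite /insertion_op raddf_sum mulr_sumr -!sumrMnl -sumrB mulr_sumr.
Qed.

(** The last letter is always a right-to-left maximum, since nothing follows it. *)
Lemma BW_last_lt0 n (w : sperm n.+1) : BW w -> last 0 (wvals w) < 0.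
Proof.
move=> /forallP/(_ ord_max)/implyP BWw.
rewrite (last_nth 0) size_wvals /= -[n]/(nat_of_ord (@ord_max n)) nth_wvals; apply: BWw.
by apply/forallP=> j; apply/implyP=> /=; have := ltn_ord j; lia.
Qed.

Lemma sum_insert_small n (w : sperm n) : BW w ->
  \sum_(i : 'I_n.+1) \sum_(b : bool | (i == n :> nat) ==> b)
     'X^(des (insert_small (i, b, w))) = insertion_op n 'X^(des w).
Proof.
move=> BWw; transitivity
  (\sum_(i < n.+1) \sum_(b : bool | (i == n :> nat) ==> b)
     ('X : {poly int}) ^+ seq_des 0 (seq_insert i ((-1) ^+ b) [seq away x | x <- wvals w])).
  by apply: eq_bigr => i _; apply: eq_bigr => b _; rewrite des_wvals wvals_insert_small.
(* The empty word has no negative last letter and is treated apart: only -1 can be inserted, with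
   one descent. *)
case: n w BWw => [|n] w BWw.
  rewrite big_ord_recl big_ord0 addr0 (big_pred1 true); last by case.
  by rewrite des_wvals (size0nil (size_wvals w)) (insertion_opXn (q := 0)) // add0r.
have szE : size [seq away x | x <- wvals w] = n.+1 by rewrite size_map size_wvals.
rewrite des_wvals -seq_des_away.
have := @sum_seq_insert0 [seq away x | x <- wvals w]; rewrite szE; apply.
- by rewrite -size_eq0 szE.
- apply/allP=> _ /mapP[_ /mapP[k _ ->] ->].
  by have := wval_norm w k; rewrite /away; lia.
- have lastE := last_map away (wvals w) 0; rewrite [away 0]addr0 in lastE.
  rewrite lastE.
  by move: (last _ _) (BW_last_lt0 BWw) => x; rewrite /away; lia.
Qed.

Lemma sum_BW_rec n :
  \sum_(w : sperm n.+1 | BW w) 'X^(des w) =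
  insertion_op n (\sum_(w : sperm n | BW w) 'X^(des w)).
Proof.
rewrite (reindex (@insert_small n)) /=; last exact/onW_bij/insert_small_bij.
rewrite insertion_op_sum.
rewrite -[RHS](eq_bigr _ (fun w BWw => sum_insert_small BWw)).
under [RHS]eq_bigr => w _ do rewrite pair_big_dep /=.
rewrite exchange_big pair_big /=.
by apply: eq_big => [[[i b] w]|[[i b] w] _] //=; rewrite BW_insert_small.
Qed.

(** * Type-B Stirling numbers *)

Fixpoint stirlingB (n k : nat) : nat :=
  match n, k with
  | 0, 0 => 1
  | 0, _.+1 => 0
  | n'.+1, 0 => stirlingB n' 0
  | n'.+1, k'.+1 => stirlingB n' k' + k.*2.+1 * stirlingB n' k
  end.

Lemma stirlingB_small n k : (n < k)%N -> stirlingB n k = 0%N.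
Proof.
elim: n k => [|n IH] [|k] //= nk.
by rewrite !IH ?muln0 // ltnW.
Qed.

(** It allows one range of summation, set by the ambient dimension, for flats of every dimension. *)
Lemma sum_stirlingB_wide (V : nmodType) (F : nat -> V) n m : (n <= m)%N ->
  \sum_(k < m.+1) F k *+ stirlingB n k = \sum_(k < n.+1) F k *+ stirlingB n k.
Proof.
move=> nm; rewrite [RHS](big_ord_widen m.+1 (fun k => F k *+ stirlingB n k)) //.
rewrite [RHS]big_mkcond /=; apply: eq_bigr => k _; rewrite ltnS.
by case: leqP => // nk; rewrite stirlingB_small ?mulr0n.
Qed.

(** The recurrence is moved from the Stirling numbers onto the weights [F]; the identities below
    then hold term by term. *)
Lemma sum_stirlingBS (V : nmodType) (F : nat -> V) n :
  \sum_(k < n.+2) F k *+ stirlingB n.+1 k =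
  \sum_(k < n.+1) (F k.+1 + F k *+ k.*2.+1) *+ stirlingB n k.
Proof.
under [RHS]eq_bigr => k _ do rewrite mulrnDl.
rewrite big_split /= big_ord_recl /=.
under eq_bigr => k _ do rewrite /bump /= add1n mulrnDr mulrnA.
rewrite big_split /= addrCA; congr (_ + _).
transitivity (\sum_(k < n.+2) F k *+ k.*2.+1 *+ stirlingB n k).
  by rewrite [RHS]big_ord_recl.
by rewrite big_ord_recr /= stirlingB_small // mulr0n addr0.
Qed.

(** The double factorial (2k-1)!!, equal to 1 at k = 0. *)
Definition dfact_odd (k : nat) : nat := \prod_(i < k) i.*2.+1.

Lemma dfact_oddS k : dfact_odd k.+1 = (dfact_odd k * k.*2.+1)%N.
Proof. by rewrite /dfact_odd big_ord_recr. Qed.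

(** The weights satisfy F(k+1) + (2k+1) F(k) = 0. This will be the vanishing sum that characterizes
    the Möbius function. *)
Lemma alternating_stirlingB n : (0 < n)%N ->
  \sum_(k < n.+1) ((-1) ^+ k * (dfact_odd k)%:R : int) *+ stirlingB n k = 0.
Proof.
case: n => // n _.
rewrite (sum_stirlingBS (fun k => (-1) ^+ k * (dfact_odd k)%:R : int)).
apply: big1 => k _; rewrite exprS dfact_oddS natrM mulN1r mulNr mulrA [_ * k.*2.+1%:R]mulr_natr.
by rewrite addNr mul0rn.
Qed.

(* In a flat of dimension [k], the number of integer points with coordinates in
   [[-m, m]] that lie on no smaller flat. *)
Definition npoints (m k : nat) : nat := (2 ^ k * m ^_ k)%N.

(** The weights satisfy F(k+1) = 2 (m-k) F(k), hence F(k+1) + (2k+1) F(k) = (2m+1) F(k). *)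
Lemma sum_stirlingB_points n m :
  \sum_(k < n.+1) (npoints m k)%:Z *+ stirlingB n k = m.*2.+1%:Z ^+ n.
Proof.
elim: n => [|n IH]; first by rewrite big_ord_recl big_ord0 /npoints ffactn0.
rewrite (sum_stirlingBS (fun k => (npoints m k)%:Z)) exprS -IH mulr_sumr.
apply: eq_bigr => k _; rewrite mulrnAr; congr (_ *+ _).
rewrite /npoints expnS ffactnSr; have [km|mk] := leqP k m; last first.
  by rewrite ffact_small // !muln0 mul0rn addr0 mulr0.
rewrite -mulr_natr -(subnK km); move: (m - k)%N (_ ^_ k)%N (2 ^ k)%N => r u v.
rewrite addnK natz -!PoszM -PoszD; congr Posz; rewrite -!muln2; ring.
Qed.

(** The system is triangular: at m = k the terms above [k] vanish, those below agree by induction,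
    and the k-th weight 2^k k! is nonzero. *)
Lemma points_basis_inj (n : nat) (c c' : nat -> nat) :
    (forall m, \sum_(k < n.+1) (npoints m k)%:Z *+ c k =
               \sum_(k < n.+1) (npoints m k)%:Z *+ c' k) ->
  forall k, (k <= n)%N -> c k = c' k.
Proof.
move=> eqcc' k; elim/ltn_ind: k => k IH kn; have := eqcc' k.
pose k0 : 'I_n.+1 := inord k; have k0E : k0 = k :> nat by rewrite inordK.
rewrite [X in X = _ -> _](bigD1 k0) // [X in _ = X -> _](bigD1 k0) //= k0E.
rewrite [X in _ + X = _ -> _](eq_bigr (fun i : 'I_n.+1 => (npoints k i)%:Z *+ c' i)); last first.
  move=> i; rewrite -val_eqE /= k0E => ik.
  have [lt_ik|le_ki] := ltnP i k; first by rewrite IH // -ltnS.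
  have lt_ki : (k < i)%N by lia.
  by rewrite /npoints ffact_small // muln0 !mul0rn.
move/addIr/mulrIn; apply.
by rewrite /npoints ffactnn -lt0n muln_gt0 expn_gt0 fact_gt0.
Qed.

Lemma insertion_opMn n p m : insertion_op n (p *+ m) = insertion_op n p *+ m.
Proof.
rewrite /insertion_op derivMn -[RHS]mulrnAr mulrnBl; congr (_ * (_ - _)).
  exact: mulrnAC.
by rewrite mulrnAr mulrnAC.
Qed.

(** The powers of z-1 are eigenvectors of (z-1) d/dz, which leaves the factor 2k+1; the outer factor
    z is split as 1 + (z-1). *)
Lemma insertion_op_Xsub1n k d :
  insertion_op (d + k) (('X - 1) ^+ d) = (('X - 1) ^+ d + ('X - 1) ^+ d.+1) *+ k.*2.+1.
Proof.
have deriv_t : ('X - 1) * (('X - 1) ^+ d)^`() = ('X - 1) ^+ d *+ d :> {poly int}.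
  rewrite deriv_exp derivXsubC mul1r mulrnAr -exprS.
  by case: d => [|d] //=; rewrite !mulr0n.
rewrite /insertion_op deriv_t -mulrnA muln2 doubleD -addnS mulrnDr addrC addKr.
by rewrite mulrnAr exprS; congr (_ *+ _); rewrite mulrBl mul1r [RHS]addrC subrK.
Qed.

Lemma sum_dfact_stirlingB_rec n :
  \sum_(k < n.+2) ((dfact_odd k)%:R * ('X - 1) ^+ (n.+1 - k) : {poly int}) *+ stirlingB n.+1 k =
  insertion_op n
   (\sum_(k < n.+1) ((dfact_odd k)%:R * ('X - 1) ^+ (n - k)) *+ stirlingB n k).
Proof.
rewrite (sum_stirlingBS (fun k => (dfact_odd k)%:R * ('X - 1) ^+ (n.+1 - k) : {poly int})).
rewrite insertion_op_sum; apply: eq_bigr => k _.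
have kn : (k <= n)%N by rewrite -ltnS.
rewrite insertion_opMn subSS (subSn kn) dfact_oddS; congr (_ *+ _).
rewrite !mulr_natl insertion_opMn.
have := insertion_op_Xsub1n k (n - k); rewrite subnK // => ->.
by rewrite mulrnA -!mulrnDl mulrnAC.
Qed.

(** * Uniqueness of the Möbius function *)

Section Mobius.
Variables (T : eqType) (s : seq T) (le : rel T) (b : T) (f : T -> int).
Hypotheses (le_refl : reflexive le) (le_trans : transitive le) (le_anti : antisymmetric le).
Hypotheses (us : uniq s) (bs : b \in s) (b_min : {in s, forall y, le b y}).
Hypothesis fb : f b = 1.
Hypothesis f_sum : {in s, forall y, y != b -> \sum_(z <- s | le z y) f z = 0}.

(** The fuel that the recursion needs at [y]. *)
Let below y := count (fun z => le z y && (z != y)) s.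

Lemma below_lt z y : z \in s -> le z y -> z != y -> (below z < below y)%N.
Proof.
move=> zs zy nzy; rewrite -addn1.
have <- : count_mem z s = 1%N by rewrite count_uniq_mem // zs.
rewrite -count_predUI (@eq_count _ (predI _ _) pred0) ?count_pred0 ?addn0; last first.
  by move=> u /=; case: eqVneq => [->|]; rewrite ?eqxx ?andbF.
apply: sub_count => u /= /orP[/andP[uz nuz]|/eqP->]; last by rewrite zy.
rewrite (le_trans uz zy); apply: contra nzy => /eqP uy.
by apply/eqP/le_anti; rewrite zy -uy.
Qed.

(** Isolating the term [z = y] in [f_sum] gives the recursion of [mob_rec], and [below] drops at
    each of its steps. *)
Lemma mob_rec_eq k : {in s, forall y, (below y <= k)%N -> mob_rec s le k b y = f y}.
Proof.
elim: k => [|k IH] y ys ky /=; have [<-|nby] := eqVneq b y; rewrite ?fb //.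
  (* Fuel 0 forces [y = b], as any other [y] has [b] strictly below it. *)
  by have := leq_trans (below_lt bs (b_min ys) nby) ky.
rewrite b_min //; apply/eqP; rewrite eq_sym -addr_eq0.
rewrite -[X in _ == X](f_sum ys _); last by rewrite eq_sym.
rewrite [X in _ == X]big_mkcond [X in _ == X](bigD1_seq y) //= le_refl -big_mkcondr; apply/eqP; congr (_ + _).
rewrite big_seq_cond [RHS]big_seq_cond; apply: eq_big => z.
  by case zs: (z \in s) => //=; rewrite b_min //= andbC.
case/andP=> zs /andP[/andP[_ zy] nzy]; apply: IH => //.
by rewrite -ltnS; apply: leq_trans ky; exact: below_lt.
Qed.

Lemma mobius_eq : {in s, forall y, mobius s le b y = f y}.
Proof. by move=> y ys; apply: mob_rec_eq => //; exact: count_size. Qed.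

End Mobius.

(** * Flats as signed retractions of the coordinates *)

Section Flats.
Variables (R : realFieldType) (n : nat).
Implicit Types (x y : 'rV[R]_n) (X Y Z : {vspace 'rV[R]_n}) (i j k l : 'I_n).

(** Signs are data independent of [R], because the same sign also acts on the finite type [box] of
    coordinates. *)
Definition signv (e : option bool) : R := if e is Some b then (-1) ^+ b else 0.

Definition signM (e f : option bool) : option bool :=
  if e is Some a then (if f is Some b then Some (a (+) b) else None) else None.

Lemma signvM e f : signv (signM e f) = signv e * signv f.
Proof. by case: e f => [a|] [b|] /=; rewrite ?mulr0 ?mul0r // signr_addb. Qed.

Lemma signv_eq0 e : (signv e == 0) = (e == None).
Proof. by case: e => [b|] /=; rewrite ?eqxx ?signr_eq0. Qed.

Lemma hypP (a : 'rV[R]_n) x : (x \in hyp a) = ((x *m a^T) 0 0 == 0).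
Proof.
rewrite /hyp memv_ker lfunE /=; apply/eqP/eqP=> [->|xa0]; first by rewrite mxE.
by apply/matrixP=> i j; rewrite !ord1 xa0 mxE.
Qed.

Lemma evec_dot x i : (x *m (evec R i)^T) 0 0 = x 0 i.
Proof.
by rewrite trmx_delta -colE mxE.
Qed.

Lemma hyp_evec x i : (x \in hyp (evec R i)) = (x 0 i == 0).
Proof. by rewrite hypP evec_dot. Qed.

Lemma hyp_evecB x i j : (x \in hyp (evec R i - evec R j)) = (x 0 i == x 0 j).
Proof. by rewrite hypP linearB /= mulmxBr mxE [X in _ + X]mxE !evec_dot subr_eq0. Qed.

Lemma hyp_evecD x i j : (x \in hyp (evec R i + evec R j)) = (x 0 i == - x 0 j).
Proof. by rewrite hypP linearD /= mulmxDr mxE !evec_dot addr_eq0. Qed.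

(** One form covers the three families of hyperplanes, with sign 0 for the coordinate ones. *)
Definition sign_eq x i (e : option bool) j := x 0 i == signv e * x 0 j.

Lemma hypi_sign_eq (h : 'I_(size (Bnormals R n))) :
  exists i e j, forall x, (x \in hypi h) = sign_eq x i e j.
Proof.
have : nth 0 (Bnormals R n) h \in Bnormals R n by apply: mem_nth.
rewrite /hypi; move: (nth _ _ _) => a; rewrite /Bnormals !mem_cat.
case/or3P=> [/allpairsPdep[i [j [_ _ ->]]]|/allpairsPdep[i [j [_ _ ->]]]|/mapP[i _ ->]].
- by exists i, (Some false), j => x; rewrite hyp_evecB /sign_eq mul1r.
- by exists i, (Some true), j => x; rewrite hyp_evecD /sign_eq mulN1r.
- by exists i, None, i => x; rewrite hyp_evec /sign_eq mul0r.
Qed.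

Lemma sign_eq_hypi i (e : option bool) j : (e != None) ==> (i != j) ->
  exists h : 'I_(size (Bnormals R n)), forall x, (x \in hypi h) = sign_eq x i e j.
Proof.
have hyp_of a : a \in Bnormals R n ->
    exists h : 'I_(size (Bnormals R n)), hypi h = hyp a.
  by move=> aB; rewrite -index_mem in aB; exists (Ordinal aB); rewrite /hypi nth_index // -index_mem.
(* [Bnormals] lists pairs with [i < j] only; a nonzero sign is its own inverse, so the equation is
   symmetric in [i] and [j]. *)
wlog lt_ij : i j / (e != None) ==> (i < j)%N.
  case: e => [e|] wlt nij; last exact: wlt.
  case: (ltngtP i j) nij => [lt_ij|lt_ji|/val_inj->]; last by rewrite eqxx.
    by move=> nij; exact: wlt.
  move=> _; have [|h hE] := wlt j i lt_ji; first by rewrite -val_eqE /=; lia.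
  exists h => x; rewrite hE /sign_eq /=.
  by rewrite -[LHS](inj_eq (can_inj (signrMK e))) signrMK eq_sym.
move=> _; case: e lt_ij => [[]|] /= lt_ij.
- have [|h hE] := hyp_of (evec R i + evec R j).
    rewrite !mem_cat; apply/or3P/Or32/allpairsPdep; exists i, j.
    by rewrite !mem_enum mem_filter lt_ij mem_enum.
  by exists h => x; rewrite hE hyp_evecD /sign_eq mulN1r.
- have [|h hE] := hyp_of (evec R i - evec R j).
    rewrite !mem_cat; apply/or3P/Or31/allpairsPdep; exists i, j.
    by rewrite !mem_enum mem_filter lt_ij mem_enum.
  by exists h => x; rewrite hE hyp_evecB /sign_eq mul1r.
- have [|h hE] := hyp_of (evec R i).
    by rewrite !mem_cat; apply/or3P/Or33; rewrite map_f ?mem_enum.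
  by exists h => x; rewrite hE hyp_evec /sign_eq mul0r.
Qed.

Lemma mem_flat_of (A : {set 'I_(size (Bnormals R n))}) x :
  (x \in flat_of A) = [forall h in A, x \in hypi h].
Proof.
rewrite memvE; apply/subv_bigcapP/forall_inP=> xA h hA; have := xA h hA; by rewrite memvE.
Qed.

(** A signed partition: [s i = None] marks the zero block, and any other [i] has the representative
    [c i] of its block and a sign relative to it. *)
Definition signed_retraction (c : 'I_n -> 'I_n) (s : 'I_n -> option bool) :=
  forall i, s i != None -> s (c i) = Some false /\ c (c i) = c i.

Definition parametrizes c s X :=
  forall x, (x \in X) = [forall i, sign_eq x i (s i) (c i)].

Definition free_coords (c : 'I_n -> 'I_n) (s : 'I_n -> option bool) : {set 'I_n} :=
  [set i | (s i == Some false) && (c i == i)].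

Lemma mem_free_coords c s i : signed_retraction c s -> s i != None -> c i \in free_coords c s.
Proof. by move=> rcs /rcs[sc cc]; rewrite inE sc cc !eqxx. Qed.

(** The block of [b] joins that of [b'] with its signs multiplied by [g], or falls into the zero
    block if [g] is [None]. *)
Lemma parametrizes_merge c s X b (g : option bool) b' :
    signed_retraction c s -> parametrizes c s X -> b \in free_coords c s ->
    (g != None) ==> (b' \in free_coords c s) && (b' != b) ->
  exists c' s', signed_retraction c' s' /\
    forall x, [forall i, sign_eq x i (s' i) (c' i)] = (x \in X) && sign_eq x b g b'.
Proof.
move=> rcs pX; rewrite !inE => /andP[/eqP sb /eqP cb] gb'.
exists (fun i => if c i == b then b' else c i), (fun i => if c i == b then signM (s i) g else s i).
split.
  move=> i /=; have [ci|nci] := eqVneq (c i) b.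
    case: (s i) => //= a; case: g gb' => //= g /andP[/andP[/eqP sb' /eqP cb'] nb'] _.
    by rewrite cb' (negbTE nb').
  by move=> /rcs[sc cc]; rewrite cc (negbTE nci).
move=> x; rewrite pX; apply/forallP/andP=> [xc'|[/forallP xc /eqP xb] i]; last first.
  rewrite /sign_eq; have [ci|nci] := eqVneq (c i) b; last exact: xc.
  by rewrite signvM -mulrA -xb -ci; exact: xc.
have xb : sign_eq x b g b' by have := xc' b; rewrite cb eqxx sb /signM; case: (g).
split=> //; apply/forallP=> i; have := xc' i; case: eqP => // ci.
by rewrite /sign_eq signvM -mulrA -(eqP xb) ci.
Qed.

Lemma parametrizes_cap_sign_eq c s X i e j :
    signed_retraction c s -> parametrizes c s X ->
  exists c' s', signed_retraction c' s' /\
    forall x, [forall i, sign_eq x i (s' i) (c' i)] = (x \in X) && sign_eq x i e j.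
Proof.
move=> rcs pX.
have eqX x k : x \in X -> x 0 k = signv (s k) * x 0 (c k).
  by rewrite pX => /forallP/(_ k)/eqP.
have same : (forall x, x \in X -> sign_eq x i e j) -> exists c' s', signed_retraction c' s' /\
    forall x, [forall i, sign_eq x i (s' i) (c' i)] = (x \in X) && sign_eq x i e j.
  by move=> Xij; exists c, s; split=> // x; rewrite -pX; case xX: (x \in X) => //; rewrite Xij.
have merge b g b' : b \in free_coords c s ->
    (g != None) ==> (b' \in free_coords c s) && (b' != b) ->
    (forall x, x \in X -> sign_eq x i e j = sign_eq x b g b') ->
    exists c' s', signed_retraction c' s' /\
    forall x, [forall i, sign_eq x i (s' i) (c' i)] = (x \in X) && sign_eq x i e j.
  move=> bF gb' Xij; have [c' [s' [rcs' E]]] := parametrizes_merge rcs pX bF gb'.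
  by exists c', s'; split=> // x; rewrite E; case xX: (x \in X) => //; rewrite Xij.
(* If [x_i] vanishes on [X], the equation is void or kills the representative of [j]. *)
case si: (s i) => [a|]; last first.
  case sj: (signM e (s j)) => [a|].
    have sj0 : s j != None by case: (s j) sj => //; case: (e).
    apply: (merge (c j) None (c j)) => [|//|x xX]; first exact: mem_free_coords.
    rewrite /sign_eq (eqX x i) // (eqX x j) // si !mul0r mulrA -signvM sj eq_sym.
    by rewrite mulf_eq0 signv_eq0.
  by apply: same => x xX; rewrite /sign_eq (eqX x i) // (eqX x j) // si mulrA -signvM sj !mul0r.
have ciF : c i \in free_coords c s by apply: mem_free_coords; rewrite ?si.
(* On [X] the equation reads [x_(c i) = h x_(c j)], the sign of [i] being moved to the right. *)
pose h := signM (Some a) (signM e (s j)).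
have Xij x : x \in X -> sign_eq x i e j = sign_eq x (c i) h (c j).
  move=> xX; rewrite /sign_eq (eqX x i) // (eqX x j) // si /h !signvM /=.
  by rewrite -[LHS](inj_eq (can_inj (signrMK a))) signrMK !mulrA.
have [cij|ncij] := eqVneq (c i) (c j); last first.
  apply: (merge _ _ _ ciF _ Xij); apply/implyP=> h0; rewrite eq_sym ncij andbT.
  by apply: mem_free_coords => //; move: h0; rewrite /h; case: (s j) (e) => [?|] [?|].
(* Within one block, sign -1 means 2x = 0 and kills the block, sign 1 is void, and sign 0 kills
   it. *)
case hE: h => [[]|].
- apply: (merge (c i) None (c i)) => // x xX; rewrite Xij // /sign_eq hE -cij mul0r /= expr1 mulN1r.
  by rewrite -addr_eq0 -mulr2n mulrn_eq0.
- by apply: same => x xX; rewrite Xij // /sign_eq hE -cij mul1r.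
- by apply: (merge (c i) None (c j)) => // x xX; rewrite Xij // hE.
Qed.

Lemma flat_of_parametrized A :
  exists c s, signed_retraction c s /\ parametrizes c s (flat_of (R := R) (n := n) A).
Proof.
rewrite /flat_of; elim/big_rec: _ => [|h X _ [c [s [rcs pX]]]].
  exists id, (fun=> Some false); split=> // x; rewrite memvf; apply/esym/forallP=> i.
  by rewrite /sign_eq mul1r.
have [i [e [j hE]]] := hypi_sign_eq h.
have [c' [s' [rcs' E]]] := parametrizes_cap_sign_eq i e j rcs pX.
by exists c', s'; split=> // x; rewrite E memv_cap hE andbC.
Qed.

End Flats.

(** * Basis and dimension of a parametrized flat *)

Section Param.
Variables (R : realFieldType) (n : nat).
Implicit Types (x y : 'rV[R]_n) (i j k l : 'I_n).
Variables (c : 'I_n -> 'I_n) (s : 'I_n -> option bool) (X : {vspace 'rV[R]_n}).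
Hypotheses (rcs : signed_retraction c s) (pX : parametrizes c s X).

Let F := free_coords c s.

(** For free [i], the point of [X] with free coordinate 1 at [i] and 0 elsewhere; these points form
    a basis of [X]. *)
Definition coord_vec i : 'rV[R]_n := \row_l (signv R (s l) *+ (c l == i)).

Lemma coord_vec_in i : coord_vec i \in X.
Proof.
rewrite pX; apply/forallP=> l; rewrite /sign_eq !mxE.
have [->|/rcs[-> ->]] := eqVneq (s l) None; first by rewrite mul0rn mul0r.
by rewrite mulrnAr /= mulr1.
Qed.

Lemma coord_vec_free i j : i \in F -> j \in F -> coord_vec i 0 j = (j == i)%:R.
Proof. by rewrite !inE !mxE => _ /andP[/eqP-> /eqP->]. Qed.

Lemma coord_vec_sum x : x \in X -> x = \sum_(i in F) x 0 i *: coord_vec i.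
Proof.
rewrite pX => /forallP xc; apply/rowP=> l; rewrite summxE (eqP (xc l)).
have [sl|sl] := eqVneq (s l) None.
  by rewrite sl mul0r big1 // => i _; rewrite !mxE sl mul0rn mulr0.
rewrite (bigD1 (c l)) ?mem_free_coords //= big1 ?addr0; last first.
  by move=> i /andP[_ ni]; rewrite !mxE eq_sym (negbTE ni) mulr0.
by rewrite !mxE eqxx mulrC.
Qed.

Lemma dim_free_coords : \dim X = #|F|.
Proof.
have szE : size [seq coord_vec i | i in F] == #|F| by rewrite size_image.
pose t := Tuple szE.
have tnth_t (k : 'I_#|F|) : t`_k = coord_vec (enum_val k).
  by rewrite /t /= nth_image.
have free_t : free t.
  apply/freeP=> a a0 k; have := congr1 (fun v : 'rV_n => v 0 (enum_val k)) a0.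
  rewrite summxE (bigD1 k) //= big1 ?addr0; last first.
    move=> l nlk; rewrite tnth_t mxE coord_vec_free ?enum_valP //.
    by rewrite (inj_eq enum_val_inj) eq_sym (negbTE nlk) mulr0.
  by rewrite tnth_t mxE coord_vec_free ?enum_valP // eqxx mulr1 mxE.
have -> : X = <<t>>%VS.
  apply/eqP; rewrite eqEsubv; apply/andP; split.
    apply/subvP=> x xX; rewrite (coord_vec_sum xX); apply: memv_suml => i iF.
    by apply: memvZ; apply: memv_span; apply/imageP; exists i.
  by apply/span_subvP=> _ /imageP[i _ ->]; exact: coord_vec_in.
by rewrite (eqP free_t) size_tuple.
Qed.

End Param.

(** * Counting integer points of flats *)

Section Points.
Variables (R : realFieldType) (n m : nat).
Implicit Types (x y : 'rV[R]_n) (X Y Z : {vspace 'rV[R]_n}) (i j k l : 'I_n).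

(* [None] is [0] and [Some (b, a)] is [(-1)^b (a + 1)]: the integers from [-m] to [m]. *)
Definition box := option (bool * 'I_m).

Definition boxv (d : box) : R := if d is Some (b, a) then (-1) ^+ b * a.+1%:R else 0.

Definition sign_act (e : option bool) (d : box) : box :=
  if e is Some b then (if d is Some (b', a) then Some (b (+) b', a) else None) else None.

Lemma boxv_act e d : boxv (sign_act e d) = signv R e * boxv d.
Proof.
case: e d => [b|] [[b' a]|] /=; rewrite ?mulr0 ?mul0r //.
by rewrite signr_addb mulrA.
Qed.

Lemma boxv_inj : injective boxv.
Proof.
have nz b (a : 'I_m) : (-1) ^+ b * a.+1%:R != 0 :> R.
  by rewrite mulf_neq0 ?signr_eq0 ?pnatr_eq0.
move=> [[b a]|] [[b' a']|] //= => [eqv|/eqP|/esym/eqP]; rewrite ?(negbTE (nz _ _)) //.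
have eqa : a = a'.
  have := congr1 (fun u : R => `|u|) eqv; rewrite !normrMsign !normr_nat => /eqP.
  by rewrite eqr_nat eqSS => /eqP/val_inj.
move: eqv; rewrite eqa => /(mulIf _); rewrite pnatr_eq0 => /(_ isT) eqb.
have -> // : b = b'.
by move/eqP: eqb; case: b b' => [] []; rewrite ?expr0 ?expr1 // -?addr_eq0 ?(eq_sym (-1)) -?addr_eq0 -mulr2n pnatr_eq0.
Qed.

Definition point (d : {ffun 'I_n -> box}) : 'rV[R]_n := \row_i boxv (d i).

Lemma sign_eq_point d i e j : sign_eq (point d) i e j = (d i == sign_act e (d j)).
Proof. by rewrite /sign_eq !mxE -boxv_act (inj_eq boxv_inj). Qed.

Lemma sign_act_comp e f d : sign_act (signM e f) d = sign_act e (sign_act f d).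
Proof. by case: e f d => [b|] [b'|] [[b'' a]|] //=; rewrite addbA. Qed.

(** The smallest flat through [x]. *)
Definition point_flat x : {vspace 'rV[R]_n} := flat_of [set h | x \in hypi h].

Lemma mem_point_flat x : x \in point_flat x.
Proof. by rewrite mem_flat_of; apply/forall_inP=> h; rewrite inE. Qed.

Lemma point_flat_sub x X : X \in Bflats R n -> (point_flat x <= X)%VS = (x \in X).
Proof.
rewrite mem_undup => /mapP[A _ ->]; apply/idP/idP=> [/subvP-> //|]; first exact: mem_point_flat.
rewrite mem_flat_of => /forall_inP xA; apply/subv_bigcapP=> h hA.
by apply: (bigcapv_inf h); rewrite ?inE ?xA.
Qed.

Lemma point_flat_in x : point_flat x \in Bflats R n.
Proof. by rewrite mem_undup; apply/mapP; exists [set h | x \in hypi h]; rewrite ?mem_enum. Qed.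

Section Count.
Variables (c : 'I_n -> 'I_n) (s : 'I_n -> option bool) (X : {vspace 'rV[R]_n}).
Hypotheses (rcs : signed_retraction c s) (pX : parametrizes c s X).
Hypothesis XB : X \in Bflats R n.
Local Notation F := (free_coords c s).
Local Notation T := {i : 'I_n | i \in F}.

Lemma card_free_coords_type : #|{: T}| = #|F|.
Proof. by rewrite card_sig; apply: eq_card => i; rewrite inE. Qed.

(** The default [None], that is 0, is met only in the zero block, where the coordinate vanishes
    anyway. *)
Definition extend (e : {ffun T -> box}) : {ffun 'I_n -> box} :=
  [ffun l => if insub (c l) is Some t then sign_act (s l) (e t) else None].

Lemma extend_val e (t : T) : extend e (val t) = e t.
Proof.
have := valP t; rewrite ffunE inE => /andP[/eqP-> /eqP->].
by rewrite valK /=; case: (e t) => [[[] a]|].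
Qed.

Lemma extend_inj : injective extend.
Proof. by move=> e e' eqe; apply/ffunP=> t; rewrite -!extend_val eqe. Qed.

Lemma point_in d : (point d \in X) = [forall i, d i == sign_act (s i) (d (c i))].
Proof. by rewrite pX; apply: eq_forallb => i; rewrite sign_eq_point. Qed.

Lemma extend_in e : point (extend e) \in X.
Proof.
rewrite point_in; apply/forallP=> i; have [si|si] := eqVneq (s i) None.
  by rewrite ffunE si; case: insubP.
have cF := mem_free_coords rcs si; rewrite -[c i]/(val (Sub (c i) cF : T)) extend_val.
by rewrite ffunE (insubT (fun i => i \in F) cF).
Qed.

Lemma extendK d : point d \in X -> d = extend [ffun t : T => d (val t)].
Proof.
rewrite point_in => /forallP dX; apply/ffunP=> i; rewrite (eqP (dX i)) ffunE.
have [->|si] := eqVneq (s i) None; first by case: insubP.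
have cF := mem_free_coords rcs si.
by rewrite (insubT (fun i => i \in F) cF) ffunE.
Qed.

Lemma card_points_in : #|[set d | point d \in X]| = (m.*2.+1 ^ #|F|)%N.
Proof.
transitivity #|extend @: [set: {ffun T -> box}]|.
  apply: eq_card => d; rewrite inE; apply/idP/imsetP=> [dX|[e _ ->]]; last exact: extend_in.
  by exists [ffun t => d (val t)]; rewrite ?inE //; exact: extendK.
rewrite card_imset ?cardsT; last exact: extend_inj.
by rewrite card_ffun card_free_coords_type card_option card_prod card_bool card_ord mul2n.
Qed.

(** All free coordinates are nonzero, with signs [p.1] and absolute values given by [p.2]; when
    [p.2] is injective the point lies on no smaller flat. *)
Definition generic_point (p : {ffun T -> bool} * {ffun T -> 'I_m}) : {ffun 'I_n -> box} :=
  extend [ffun t => Some (p.1 t, p.2 t)].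

Lemma generic_point_inj : injective generic_point.
Proof.
move=> [g f] [g' f'] /extend_inj/ffunP eqe.
by congr (_, _); apply/ffunP=> t; have := eqe t; rewrite !ffunE => -[].
Qed.

(** Distinct nonzero absolute values make every sign equation satisfied by the point hold on all of
    [X]. *)
Lemma point_flat_generic g (f : {ffun T -> 'I_m}) :
  injectiveb f -> point_flat (point (generic_point (g, f))) = X.
Proof.
move=> /injectiveP injf; set d := generic_point _.
have dX : point d \in X by exact: extend_in.
apply/eqP; rewrite eqEsubv point_flat_sub // dX /=.
apply/subvP=> y yX; rewrite mem_flat_of; apply/forall_inP=> h; rewrite inE.
have [i [e [j hE]]] := hypi_sign_eq h; rewrite !hE sign_eq_point.
have dT i' (iF : i' \in F) : d i' = Some (g (Sub i' iF), f (Sub i' iF)).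
  by rewrite -[i']/(val (Sub i' iF : T)) [d _]extend_val ffunE.
have dc k : d k = sign_act (s k) (d (c k)).
  by move: dX; rewrite point_in => /forallP/(_ k)/eqP.
have yc k : y 0 k = signv R (s k) * y 0 (c k).
  by move: yX; rewrite pX => /forallP/(_ k)/eqP.
rewrite /sign_eq (yc i) (yc j) mulrA -signvM (dc i) (dc j) -sign_act_comp.
have cF k := mem_free_coords (i := k) rcs.
case si: (s i) (cF i) => [a|] ciF; last first.
  case hj: (signM e (s j)) => [b|] /=; last by rewrite !mul0r.
  have sj : s j != None by case: (s j) hj => //; case: (e).
  by rewrite (dT _ (cF j sj)).
rewrite (dT _ (ciF isT)).
case hj: (signM e (s j)) => [b|] //=.
have sj : s j != None by case: (s j) hj => //; case: (e).
rewrite (dT _ (cF j sj)) => /eqP[eqs /injf eqt].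
have := congr1 val eqt; rewrite /= => ->.
by move: eqs; rewrite eqt => /addIb->.
Qed.

Lemma generic_point_flat d : point_flat (point d) = X ->
  exists2 p : {ffun T -> bool} * {ffun T -> 'I_m}, injectiveb p.2 & d = generic_point p.
Proof.
move=> dX.
(* A hyperplane through the point contains its smallest flat [X], hence [coord_vec i], which
   violates the equation. *)
have not_flat i e j (iF : i \in F) (jF : j \in F) :
    (e != None) ==> (i != j) -> d i != sign_act e (d j).
  move=> eij; rewrite -sign_eq_point; have [h hE] := sign_eq_hypi R eij.
  rewrite -hE; apply/negP=> dh.
  have : coord_vec R c s i \in hypi h.
    have := coord_vec_in rcs pX i; rewrite -dX mem_flat_of => /forall_inP; apply.
    by rewrite inE.
  rewrite hE /sign_eq (coord_vec_free R iF iF) (coord_vec_free R iF jF) eqxx.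
  case: e eij {hE} => [b|] /= nij; last by rewrite mul0r oner_eq0.
  by rewrite (eq_sym j) (negbTE nij) mulr0 oner_eq0.
have dnz (t : T) : exists a, d (val t) = Some a.
  case dt: (d (val t)) => [a|]; first by exists a.
  by have := not_flat _ None _ (valP t) (valP t) isT; rewrite dt.
have [a da] : exists a : {ffun T -> bool * 'I_m}, forall t, d (val t) = Some (a t).
  have [a da] := fin_all_exists dnz.
  by exists [ffun t => a t] => t; rewrite ffunE da.
exists ([ffun t => (a t).1], [ffun t => (a t).2]) => /=.
  apply/injectiveP=> t t'; rewrite !ffunE => eqa; apply: contraTeq isT => ntt'.
  (* Free coordinates of equal absolute value would differ by the product of their signs. *)
  have := not_flat _ (Some ((a t).1 (+) (a t').1)) _ (valP t) (valP t').
  rewrite (inj_eq val_inj) ntt' !da => /(_ isT) /=.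
  case: (a t) (a t') eqa => [b u] [b' u'] /= ->.
  by rewrite -addbA addbb addbF eqxx.
rewrite (@extendK d); last by rewrite -dX mem_point_flat.
by congr extend; apply/ffunP=> t; rewrite !ffunE da; case: (a t).
Qed.

Lemma card_points_generic : #|[set d | point_flat (point d) == X]| = npoints m #|F|.
Proof.
transitivity #|generic_point @: setX setT [set f : {ffun T -> 'I_m} | injectiveb f]|.
  apply: eq_card => d; rewrite inE; apply/eqP/imsetP=> [/generic_point_flat[p injp ->]|].
    by exists p => //; case: p injp => g f injp; rewrite inE /= !inE.
  by move=> [[g f]]; rewrite inE /= !inE => injf ->; exact: point_flat_generic.
rewrite card_imset ?cardsX; last exact: generic_point_inj.
by rewrite cardsT card_ffun card_inj_ffuns card_free_coords_type card_bool card_ord.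
Qed.

End Count.

(** Double counting: each box point of [X] is counted once, at [point_flat]. *)
Lemma sum_points_generic X : X \in Bflats R n ->
  (\sum_(Z <- Bflats R n | (Z <= X)%VS) npoints m (\dim Z) = m.*2.+1 ^ \dim X)%N.
Proof.
have paramP Z : Z \in Bflats R n ->
    exists c s, signed_retraction c s /\ parametrizes c s Z.
  by rewrite mem_undup => /mapP[A _ ->]; exact: flat_of_parametrized.
move=> XB; have [c [s [rcs pX]]] := paramP X XB.
rewrite (dim_free_coords rcs pX) -(card_points_in rcs pX).
transitivity (\sum_(Z <- Bflats R n | (Z <= X)%VS) \sum_d (point_flat (point d) == Z))%N.
  rewrite big_seq_cond [RHS]big_seq_cond; apply: eq_bigr => Z /andP[ZB _].
  have [c' [s' [rcs' pZ]]] := paramP Z ZB.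
  rewrite (dim_free_coords rcs' pZ) -(card_points_generic rcs' pZ ZB) -sum1_card big_mkcond.
  by apply: eq_bigr => d _; rewrite inE; case: eqP.
rewrite exchange_big /= -sum1_card [RHS]big_mkcond; apply: eq_bigr => d _.
rewrite inE -(point_flat_sub _ XB) big_mkcond.
rewrite (bigD1_seq (point_flat (point d))) ?point_flat_in ?undup_uniq //= eqxx.
by rewrite big1 ?addn0 // => Z nZ; rewrite eq_sym (negbTE nZ) if_same.
Qed.
End Points.

(** * The polynomial of the arrangement *)

Section Poly.
Variables (R : realFieldType) (n : nat).
Implicit Types X Z : {vspace 'rV[R]_n}.

Lemma dim_fullv_rV : \dim (fullv : {vspace 'rV[R]_n}) = n.
Proof. by rewrite dimvf; exact: mul1n. Qed.

Lemma dim_rV_le X : (\dim X <= n)%N.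
Proof. by have := dimvS (subvf X); rewrite dim_fullv_rV. Qed.

Lemma sum_flats_below (V : nmodType) (f : nat -> V) X : X \in Bflats R n ->
  \sum_(Z <- Bflats R n | (Z <= X)%VS) f (\dim Z) =
  \sum_(k < n.+1) f k *+ stirlingB (\dim X) k.
Proof.
move=> XB.
pose N k := count (fun Z => (Z <= X)%VS && (\dim Z == k)) (Bflats R n).
have sumN (W : nmodType) (g : nat -> W) :
    \sum_(Z <- Bflats R n | (Z <= X)%VS) g (\dim Z) = \sum_(k < n.+1) g k *+ N k.
  rewrite (partition_big (fun Z => inord (\dim Z) : 'I_n.+1) xpredT) //=.
  have inordE Z k : (inord (\dim Z) == k :> 'I_n.+1) = (\dim Z == k).
    by rewrite -val_eqE /= inordK // ltnS dim_rV_le.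
  apply: eq_bigr => k _; rewrite (eq_bigr (fun=> g k)); last first.
    by move=> Z /andP[_]; rewrite inordE => /eqP->.
  rewrite big_const_seq iter_addr_0; congr (_ *+ _).
  by apply: eq_count => Z; rewrite inordE.
rewrite sumN; apply: eq_bigr => k _; congr (_ *+ _).
(* Both coefficient sequences expand (2m+1)^(dim X) for every m. *)
apply: (@points_basis_inj n N (stirlingB (\dim X))) => [m|]; last by rewrite -ltnS.
rewrite -(sumN _ (fun k => (npoints m k)%:Z)) (sum_stirlingB_wide (fun k => (npoints m k)%:Z)) ?dim_rV_le // sum_stirlingB_points.
rewrite -natz -natrX -(sum_points_generic m XB) natr_sum.
by apply: eq_bigr => Z _; rewrite natz.
Qed.

Lemma flat_bot_in : flat_bot R n \in Bflats R n.
Proof. by rewrite mem_undup; apply/mapP; exists setT; rewrite ?mem_enum. Qed.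

Lemma flat_botE : flat_bot R n = 0%VS.
Proof.
apply/eqP; rewrite -subv0; apply/subvP=> x; rewrite mem_flat_of memv0 => /forall_inP x0.
apply/eqP/rowP=> i; rewrite mxE; have [h hE] := sign_eq_hypi R (isT : (None != None) ==> (i != i)).
by move: (x0 h); rewrite hE inE /sign_eq mul0r => /(_ isT)/eqP.
Qed.

Lemma mobius_flat : {in Bflats R n, forall X,
  mobius (Bflats R n) (@flat_le R n) (flat_bot R n) X = (-1) ^+ \dim X * (dfact_odd (\dim X))%:R}.
Proof.
apply: (@mobius_eq _ _ _ _ (fun X => (-1) ^+ \dim X * (dfact_odd (\dim X))%:R : int)).
- exact: subvv.
- by move=> X Y Z; exact: subv_trans.
- by move=> X Y XY; apply/eqP; rewrite eqEsubv.
- exact: undup_uniq.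
- exact: flat_bot_in.
- by move=> X _; rewrite /flat_le flat_botE sub0v.
- by rewrite flat_botE dimv0 /dfact_odd big_ord0.
move=> X XB nX0.
rewrite (sum_flats_below (fun k => (-1) ^+ k * (dfact_odd k)%:R : int) XB).
rewrite (sum_stirlingB_wide (fun k => (-1) ^+ k * (dfact_odd k)%:R : int)) ?dim_rV_le //.
by rewrite alternating_stirlingB // lt0n dimv_eq0 -flat_botE.
Qed.

(** The whole space is the empty intersection, so [sum_flats_below] covers all flats; absolute
    values strip the signs of the Möbius function. *)
Lemma PB_stirlingB :
  PB R n = \sum_(k < n.+1) ((dfact_odd k)%:R * ('X - 1) ^+ (n - k)) *+ stirlingB n k.
Proof.
have fullB : fullv \in Bflats R n.
  by rewrite mem_undup; apply/mapP; exists set0; rewrite ?mem_enum // /flat_of big_set0.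
have := sum_flats_below (fun k => (dfact_odd k)%:R * ('X - 1) ^+ (n - k) : {poly int}) fullB.
rewrite dim_fullv_rV => <-; rewrite /PB [RHS](eq_bigl xpredT) => [|Z]; last exact: subvf.
rewrite big_seq [RHS]big_seq; apply: eq_bigr => Z ZB.
by rewrite mobius_flat // abszM abszX /= exp1n mul1n natz.
Qed.

End Poly.

Theorem theorem6p3 (R : realFieldType) (n : nat) :
  (1 <= n)%N ->
  PB R n = \sum_(w : sperm n | BW w) 'X^(des w).
Proof.
(* Both sides obey the same recurrence and equal 1 at n = 0, where the only word is empty. *)
move=> _; rewrite PB_stirlingB; elim: n => [|n IH]; last by rewrite sum_dfact_stirlingB_rec IH sum_BW_rec.
rewrite big_ord_recl big_ord0 addr0 /= expr0 mulr1 mulr1n /dfact_odd big_ord0.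
pose w0 : sperm 0 := (1%g, [ffun=> false]).
rewrite (big_pred1 w0) // => w; rewrite /= (_ : w == w0); last first.
  by apply/eqP; case: w => u e; congr (_, _); [apply/permP|apply/ffunP] => -[].
by apply/forallP=> -[].
Qed.
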